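(* Let $\varepsilon\in\{1,-1\}$ and equip $M=\mathbb{R}^3$ (coordinates $(X_1,X_2,X_3)$, $\partial_i=\partial/\partial X_i$) with the metric $g=e^{2X_3}dX_1^2+e^{-2X_3}dX_2^2+\varepsilon\, dX_3^2$, and let $\nabla$ be its Levi-Civita connection. Let $R,C,K,W,P$ be the $(0,4)$ Riemann, Weyl conformal, conharmonic, concircular and projective curvature tensors, and $Ric$ the Ricci tensor, of $\nabla$ (with the sign conventions given in the context). Then: (I) The following identities hold (so that the corresponding semisymmetric type, pseudosymmetric type, or Ricci generalized pseudosymmetric type conditions hold): (1) $C\cdot R=0$; (2) $K\cdot R=-Q(Ric,R)$; (3) $W\cdot R=\frac23 Q(Ric,R)$; (4) $P\cdot R=\frac12 Q(Ric,R)$; (5) $K\cdot R=-\varepsilon Q(g,R)$; (6) $W\cdot R=\frac23\varepsilon Q(g,R)$; (7) $P\cdot R=\frac12\varepsilon Q(g,R)$; (8) $R\cdot C=0$; (9) $C\cdot C=0$; (10) $K\cdot C=0$; (11) $W\cdot C=0$; (12) $P\cdot C=0$; (13) $R\cdot K=0$; (14) $C\cdot K=0$; (15) $K\cdot K=0$; (16) $W\cdot K=0$; (17) $P\cdot K=-\frac12 Q(Ric,K)$; (18) $R\cdot W=\frac34 Q(Ric,W)$; (19) $K\cdot W=-\frac34 Q(Ric,W)$; (20) $W\cdot W=\frac12 Q(Ric,W)$; (21) $P\cdot W=\frac14 Q(Ric,W)$; (22) $R\cdot W=\varepsilon Q(g,W)$; (23) $K\cdot W=-\varepsilon Q(g,W)$;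 (24) $W\cdot W=\frac23\varepsilon Q(g,W)$; (25) $P\cdot W=\frac13\varepsilon Q(g,W)$; (26) $R\cdot P=\varepsilon Q(g,P)$; (27) $K\cdot P=-\varepsilon Q(g,P)$; (28) $W\cdot P=\frac23\varepsilon Q(g,P)$. (II) $Ric=\alpha\,(\eta\otimes\eta)$ with $\alpha=2$ and $\eta=dX_3$ (components $\{0,0,1\}$). Thus $M$ is a Ricci simple manifold, and it is a $2$-quasi-Einstein manifold with $\operatorname{rank}(Ric-\alpha g)=2$ when $\varepsilon=1$, and a $3$-quasi-Einstein manifold with $\operatorname{rank}(Ric-\alpha g)=3$ when $\varepsilon=-1$. (III) $R=g\wedge Ric-\frac{\varepsilon}{2}\,g\wedge g$; hence $M$ is a generalized Roter type manifold. (IV) $Ric^2-2\varepsilon\, Ric=0$; hence $M$ is an Einstein manifold of level $2$. (V) $Ric$ is neither of Codazzi type nor cyclic parallel. (VI) $Ric$ is $R$-compatible, $C$-compatible, $K$-compatible and $W$-compatible.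
   Context: Here $n=3$; repeated indices are summed over $1,2,3$. Christoffel coefficients: $\nabla_{\partial_k}\partial_j=\Gamma^\alpha_{kj}\partial_\alpha$. The non-zero ones are $\Gamma^1_{13}=\Gamma^1_{31}=1$, $\Gamma^2_{23}=\Gamma^2_{32}=-1$, $\Gamma^3_{11}=-\varepsilon e^{2X_3}$, $\Gamma^3_{22}=\varepsilon e^{-2X_3}$. Curvature (sign conventions matter). The $(0,4)$ Riemann curvature has components $$R_{hkij}=g_{h\alpha}\left(\partial_i\Gamma^\alpha_{kj}-\partial_j\Gamma^\alpha_{ki}+\Gamma^\beta_{kj}\Gamma^\alpha_{\beta i}-\Gamma^\beta_{ki}\Gamma^\alpha_{\beta j}\right).$$ To a $(0,4)$ tensor $E$ is associated the endomorphism-valued $\mathcal E$ by $g(\mathcal E(U_1,U_2)U_3,U_4)=E(U_1,U_2,U_3,U_4)$; $E_{hkij}=E(\partial_h,\partial_k,\partial_i,\partial_j)$. With $\mathcal E_R$ associated to $R$, $Ric(Y_1,Y_2)=\operatorname{tr}\{X\mapsto\mathcal E_R(X,Y_1)Y_2\}$, i.e. $Ric_{ij}=g^{hl}R_{hijl}$; $\kappa=g^{ij}Ric_{ij}$; the Ricci operator $\mathcal J$ is given by $Ric(Y_1,Y_2)=g(Y_1,\mathcal JY_2)$, and $Ric^k(Y_1,Y_2)=g(Y_1,\mathcal J^{k}Y_2)$ (so $Ric^1=Ric$). Kulkarni-Nomizu product of $(0,2)$-tensors $A,E$: $(A\wedge E)(Y_1,Y_2,U_1,U_2)=A(Y_1,U_2)E(Y_2,U_1)-A(Y_1,U_1)E(Y_2,U_2)+A(Y_2,U_1)E(Y_1,U_2)-A(Y_2,U_2)E(Y_1,U_1)$.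 Derived tensors: $C=R-\frac1{n-2}\,g\wedge Ric+\frac{\kappa}{2(n-1)(n-2)}\,g\wedge g$; $K=R-\frac1{n-2}\,g\wedge Ric$; $W=R-\frac{\kappa}{2n(n-1)}\,g\wedge g$; $P_{hkij}=R_{hkij}-\frac1{n-1}(g_{hj}Ric_{ki}-g_{kj}Ric_{hi})$. For a $(0,4)$ tensor $E$ with associated $\mathcal E$ and a $(0,k)$ tensor $F$: $(E\cdot F)(Y_1,\dots,Y_k,U_1,U_2)=-F(\mathcal E(U_1,U_2)Y_1,Y_2,\dots,Y_k)-\cdots-F(Y_1,\dots,\mathcal E(U_1,U_2)Y_k)$. For a $(0,2)$ tensor $Z$: $Q(Z,F)(Y_1,\dots,Y_k,U_1,U_2)=Z(U_1,Y_1)F(U_2,Y_2,\dots,Y_k)+\cdots+Z(U_1,Y_k)F(Y_1,\dots,Y_{k-1},U_2)-Z(U_2,Y_1)F(U_1,Y_2,\dots,Y_k)-\cdots-Z(U_2,Y_k)F(Y_1,\dots,Y_{k-1},U_1)$. Terminology. $M$ is $F$-semisymmetric type due to $E$ if $E\cdot F=0$; $F$-pseudosymmetric type due to $E$ if $E\cdot F$ is linearly dependent with $Q(Z,F)$; Ricci generalized $F$-pseudosymmetric type due to $E$ if $E\cdot F=f\,Q(Ric,F)$ for a scalar function $f$. $M$ is $k$-quasi-Einstein if $\operatorname{rank}(Ric-\alpha g)=k$ for a scalar $\alpha$; quasi-Einstein means $k=1$; Ricci simple means quasi-Einstein with $\alpha=0$. $M$ is generalized Roter type if $R=(\mu_{11}Ric^2+\mu_{12}Ric+\mu_{13}g)\wedge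 Ric^2+(\mu_{22}Ric+\mu_{23}g)\wedge Ric+\mu_{33}(g\wedge g)$ for some scalars $\mu_{ij}$. $M$ is Einstein of level $2$ if $Ric^2+\lambda_1Ric+\lambda_2g=0$ for some scalars $\lambda_1,\lambda_2$. $\mathcal S_{Y_1,Y_2,Y_3}$ denotes the cyclic sum. $Ric$ is cyclic parallel if $\mathcal S_{Y_1,Y_2,Y_3}(\nabla_{Y_1}Ric)(Y_2,Y_3)=0$, and Codazzi if $(\nabla_{Y_1}Ric)(Y_2,Y_3)=(\nabla_{Y_2}Ric)(Y_1,Y_3)$, for all vector fields. A symmetric $(0,2)$-tensor $Z$, with $g(\mathcal ZY_1,Y_2)=Z(Y_1,Y_2)$, is $T$-compatible if $\mathcal S_{Y_1,Y_2,Y_3}T(\mathcal ZY_1,U,Y_2,Y_3)=0$ for all vector fields. *)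

(* Defs.v *)
From HB Require Import structures.
From mathcomp Require Import all_boot all_order all_algebra.
From mathcomp Require Import all_classical all_reals all_analysis.
From mathcomp Require Import ring.
Export numFieldNormedType.Exports.

Set Implicit Arguments.
Unset Strict Implicit.
Unset Printing Implicit Defensive.

Import Order.TTheory GRing.Theory Num.Theory.
Local Open Scope ring_scope.

(* Semi-Riemannian geometry on R^3 in its global chart. Points and tangent
   vectors are both row vectors; a (0,k) tensor field takes a point, then k
   tangent vectors. Since tensors are C^oo-multilinear, statements about all
   vector fields are rendered as statements about all tangent vectors at all
   points. *)

Section Tensors.
Variable R : realType.

Definition vec := 'rV[R]_3.
Definition bil := vec -> vec -> R.
Definition tri := vec -> vec -> vec -> R.
Definition quad := vec -> vec -> vec -> vec -> R.
Definition tensor2 := vec -> bil.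
Definition tensor3 := vec -> tri.
Definition tensor4 := vec -> quad.
Definition tensor6 := vec -> vec -> vec -> vec -> vec -> vec -> vec -> R.

Definition i1 : 'I_3 := @Ordinal 3 0 isT.
Definition i2 : 'I_3 := @Ordinal 3 1 isT.
Definition i3 : 'I_3 := @Ordinal 3 2 isT.

Definition e (i : 'I_3) : vec := delta_mx 0 i.
Definition dX (i : 'I_3) : vec -> R := fun v => v 0 i.
Definition otimes (w1 w2 : vec -> R) : bil := fun u v => w1 u * w2 v.

Definition partial (i : 'I_3) (f : vec -> R) : vec -> R := fun p => 'D_(e i) f p.

Definition smooth (f : vec -> R) : Prop :=
  forall (s : seq 'I_3) (p : vec), differentiable (foldr partial f s) p.

Definition gram (A : bil) : 'M[R]_3 := \matrix_(i, j) A (e i) (e j).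

Definition ginv (g : tensor2) (p : vec) : 'M[R]_3 := invmx (gram (g p)).

(* For a linear w and a nondegenerate bilinear g, the vector X with g(X, V) = w(V) for all V. *)
Definition sharp (g : tensor2) (p : vec) (w : vec -> R) : vec :=
  (\row_m w (e m)) *m ginv g p.

Definition sym2 (Z : tensor2) : Prop := forall p u v, Z p u v = Z p v u.

(* [Gam p a k j] is the coefficient Gamma^a_{kj}(p) of
   nabla_{d_k} d_j = Gamma^a_{kj} d_a. *)
Definition connection := vec -> 'I_3 -> 'I_3 -> 'I_3 -> R.

Definition torsion_free (Gam : connection) : Prop :=
  forall p a k j, Gam p a k j = Gam p a j k.

(* (nabla_{Y1} Z)(Y2, Y3). *)
Definition nabla (Gam : connection) (Z : tensor2) : tensor3 :=
  fun p Y1 Y2 Y3 => \sum_i \sum_j \sum_k Y1 0 i * Y2 0 j * Y3 0 k *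
    (partial i (fun q => Z q (e j) (e k)) p
     - \sum_a Gam p a i j * Z p (e a) (e k)
     - \sum_a Gam p a i k * Z p (e j) (e a)).

Definition levi_civita (g : tensor2) (Gam : connection) : Prop :=
  torsion_free Gam /\ nabla Gam g = 0.

Section Curvature.
Variables (g : tensor2) (Gam : connection).

Definition riem_comp (p : vec) (h k i j : 'I_3) : R :=
  \sum_a g p (e h) (e a) *
    (partial i (fun q => Gam q a k j) p - partial j (fun q => Gam q a k i) p
     + \sum_b Gam p b k j * Gam p a b i - \sum_b Gam p b k i * Gam p a b j).

Definition riem : tensor4 := fun p Y1 Y2 U1 U2 =>
  \sum_h \sum_k \sum_i \sum_j
    Y1 0 h * Y2 0 k * U1 0 i * U2 0 j * riem_comp p h k i j.

Definition endo (E : tensor4) (p U1 U2 U3 : vec) : vec := sharp g p (E p U1 U2 U3).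

Definition ric : tensor2 := fun p Y1 Y2 =>
  \tr (lin1_mx (fun X => endo riem p X Y1 Y2)).

Definition kappa (p : vec) : R :=
  \sum_i \sum_j ginv g p i j * ric p (e i) (e j).

Definition ricci_op (p : vec) (Y : vec) : vec := sharp g p (fun V => ric p V Y).

Definition ric_pow (k : nat) : tensor2 := fun p Y1 Y2 =>
  g p Y1 (iter k (ricci_op p) Y2).

Definition KN (A E : bil) : quad := fun Y1 Y2 U1 U2 =>
  A Y1 U2 * E Y2 U1 - A Y1 U1 * E Y2 U2 + A Y2 U1 * E Y1 U2 - A Y2 U2 * E Y1 U1.

Local Notation n := (3 : R).

Definition conformal : tensor4 := fun p =>
  riem p - (n - 2)^-1 *: KN (g p) (ric p)
  + (kappa p / (2 * (n - 1) * (n - 2))) *: KN (g p) (g p).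

Definition conharmonic : tensor4 := fun p =>
  riem p - (n - 2)^-1 *: KN (g p) (ric p).

Definition concircular : tensor4 := fun p =>
  riem p - (kappa p / (2 * n * (n - 1))) *: KN (g p) (g p).

Definition projective : tensor4 := fun p Y1 Y2 U1 U2 =>
  riem p Y1 Y2 U1 U2
  - (n - 1)^-1 * (g p Y1 U2 * ric p Y2 U1 - g p Y2 U2 * ric p Y1 U1).

(* [act E F] is E . F; here and in [Q], F always has valence (0,4). *)
Definition act (E F : tensor4) : tensor6 := fun p Y1 Y2 Y3 Y4 U1 U2 =>
  - F p (endo E p U1 U2 Y1) Y2 Y3 Y4
  - F p Y1 (endo E p U1 U2 Y2) Y3 Y4
  - F p Y1 Y2 (endo E p U1 U2 Y3) Y4
  - F p Y1 Y2 Y3 (endo E p U1 U2 Y4).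

Definition Q (Z : tensor2) (F : tensor4) : tensor6 := fun p Y1 Y2 Y3 Y4 U1 U2 =>
  Z p U1 Y1 * F p U2 Y2 Y3 Y4 + Z p U1 Y2 * F p Y1 U2 Y3 Y4
  + Z p U1 Y3 * F p Y1 Y2 U2 Y4 + Z p U1 Y4 * F p Y1 Y2 Y3 U2
  - Z p U2 Y1 * F p U1 Y2 Y3 Y4 - Z p U2 Y2 * F p Y1 U1 Y3 Y4
  - Z p U2 Y3 * F p Y1 Y2 U1 Y4 - Z p U2 Y4 * F p Y1 Y2 Y3 U1.

Definition semisymmetric_type (E F : tensor4) : Prop := act E F = 0.

(* Linear dependence is pointwise. *)
Definition pseudosymmetric_type (Z : tensor2) (E F : tensor4) : Prop :=
  forall p, exists a b : R,
    ((a != 0) || (b != 0)) /\ a *: act E F p + b *: Q Z F p = 0.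

Definition ricci_gen_pseudosymmetric_type (E F : tensor4) : Prop :=
  exists2 f : vec -> R, smooth f & forall p, act E F p = f p *: Q ric F p.

Definition rank_ric_shift (alpha : vec -> R) (k : nat) : Prop :=
  forall p, \rank (gram (ric p - alpha p *: g p)) = k.

Definition quasi_einstein (k : nat) : Prop :=
  exists2 alpha, smooth alpha & rank_ric_shift alpha k.

Definition ricci_simple : Prop := rank_ric_shift (fun=> 0) 1.

Definition generalized_roter : Prop :=
  exists mu11 mu12 mu13 mu22 mu23 mu33 : vec -> R,
    [/\ smooth mu11, smooth mu12 & smooth mu13] /\
    [/\ smooth mu22, smooth mu23 & smooth mu33] /\
    forall p, riem p =
      KN (mu11 p *: ric_pow 2 p + mu12 p *: ric p + mu13 p *: g p) (ric_pow 2 p)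
      + KN (mu22 p *: ric p + mu23 p *: g p) (ric p)
      + mu33 p *: KN (g p) (g p).

Definition einstein_level2 : Prop :=
  exists lam1 lam2 : vec -> R, [/\ smooth lam1, smooth lam2 &
    forall p, ric_pow 2 p + lam1 p *: ric p + lam2 p *: g p = 0].

Definition codazzi (Z : tensor2) : Prop :=
  forall p Y1 Y2 Y3, nabla Gam Z p Y1 Y2 Y3 = nabla Gam Z p Y2 Y1 Y3.

Definition cyclic_parallel (Z : tensor2) : Prop :=
  forall p Y1 Y2 Y3,
    nabla Gam Z p Y1 Y2 Y3 + nabla Gam Z p Y2 Y3 Y1 + nabla Gam Z p Y3 Y1 Y2 = 0.

Definition compatible (T : tensor4) (Z : tensor2) : Prop :=
  sym2 Z /\
  forall p U Y1 Y2 Y3,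
    let z Y := sharp g p (Z p Y) in
    T p (z Y1) U Y2 Y3 + T p (z Y2) U Y3 Y1 + T p (z Y3) U Y1 Y2 = 0.

End Curvature.

Definition metric (eps : R) : tensor2 := fun p =>
  expR (2 * p 0 i3) *: otimes (dX i1) (dX i1)
  + expR (- 2 * p 0 i3) *: otimes (dX i2) (dX i2)
  + eps *: otimes (dX i3) (dX i3).

End Tensors.

Arguments e {R} i.
Arguments dX {R} i _.

Lemma derive_coord (R : realType) (F : R -> R) (j : 'I_3) (v p : vec R) :
  'D_v (fun q : vec R => F (q 0 j)) p = 'D_(v 0 j) F (p 0 j).
Proof.
rewrite /derive.
have -> : (fun h : R => h^-1 *: (((fun q : vec R => F (q 0 j)) \o shift p) (h *: v) - F (p 0 j)))
  = (fun h : R => h^-1 *: ((F \o shift (p 0 j)) (h *: v 0 j) - F (p 0 j))).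
  by apply/funext => h /=; rewrite !mxE.
by [].
Qed.

(* [metric eps] does have a Levi-Civita connection. *)
Definition christoffel (R : realType) (eps : R) : connection R := fun p a k j =>
  match val a, val k, val j with
  | 0%N, 0%N, 2%N | 0%N, 2%N, 0%N => 1
  | 1%N, 1%N, 2%N | 1%N, 2%N, 1%N => -1
  | 2%N, 0%N, 0%N => - eps * expR (2 * p 0 i3)
  | 2%N, 1%N, 1%N => eps * expR (- 2 * p 0 i3)
  | _, _, _ => 0
  end.

Lemma partial_metric (R : realType) (eps : R) (i j k : 'I_3) p :
  partial i (fun q => metric eps q (e j) (e k)) p =
  (i == i3)%:R * (2 * expR (2 * p 0 i3) * ((j == i1) && (k == i1))%:R
   - 2 * expR (- 2 * p 0 i3) * ((j == i2) && (k == i2))%:R).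
Proof.
set c1 : R := ((j == i1) && (k == i1))%:R.
set c2 : R := ((j == i2) && (k == i2))%:R.
pose c3 : R := eps * ((j == i3) && (k == i3))%:R.
pose F (x : R) : R := expR (2 * x) * c1 + expR (- 2 * x) * c2 + c3.
have DF (x : R) : is_derive x (1:R) F (2 * expR (2 * x) * c1 - 2 * expR (- 2 * x) * c2).
  have E (c : R) : is_derive x (1:R) (fun y : R => expR (c * y)) (expR (c * x) * c).
    by apply: is_derive1_comp; apply: is_derive_eq; rewrite /GRing.scale /= mulr1.
  apply: is_derive_eq.
  by rewrite /GRing.scale /=; ring.
rewrite /partial.
have -> : (fun q => metric eps q (e j) (e k)) = (fun q : vec R => F (q 0 i3)).
  apply/funext => q; rewrite /metric /otimes /dX /e /F /c1 /c2 /c3.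
  rewrite !(fctE, mxE) /= -!natrM !mulnb ![i1 == _]eq_sym ![i2 == _]eq_sym ![i3 == _]eq_sym.
  by rewrite /GRing.scale /= .
rewrite (derive_coord F i3 (e i) p) mxE eqxx /= [i3 == _]eq_sym.
case: (i == i3); last by rewrite derive0 mul0r.
by rewrite derive_val mul1r.
Qed.

Lemma levi_civita_christoffel (R : realType) (eps : R) :
  eps ^+ 2 = 1 -> levi_civita (metric eps) (christoffel eps).
Proof.
move=> h; split; first by move=> p [[|[|[|?]]] ?] [[|[|[|?]]] ?] [[|[|[|?]]] ?].
apply/funext => p; apply/funext => Y1; apply/funext => Y2; apply/funext => Y3.
have E a b : metric eps p (e a) (e b) =
    expR (2 * p 0 i3) * ((i1 == a)%:R * (i1 == b)%:R)
    + expR (- 2 * p 0 i3) * ((i2 == a)%:R * (i2 == b)%:R)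
    + eps * ((i3 == a)%:R * (i3 == b)%:R).
  by rewrite /metric /otimes /dX /e !(fctE, mxE).
rewrite /nabla; apply: big1 => i _; apply: big1 => j _; apply: big1 => k _.
rewrite partial_metric !big_ord_recl !big_ord0 !E.
apply/eqP; rewrite mulf_eq0; apply/orP; right; apply/eqP.
have hh : eps * eps = 1 by rewrite -expr2.
move: i j k => [[|[|[|?]]] ?] [[|[|[|?]]] ?] [[|[|[|?]]] ?] //;
 rewrite /christoffel /i1 /i2 /i3 !eqE /= ?mulNr ?(mulr1, mulr0,mul0r,addr0,add0r,mul1r,subrr,subr0,sub0r,mulrN,opprK) //.
all: by rewrite ?[eps * _ * eps]mulrAC ?mulrA ?hh ?mul1r ?subrr ?addNr //; ring : hh.
Qed.

(* Main.v *)
From HB Require Import structures.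
Require Import Defs.
From mathcomp Require Import all_boot all_order all_algebra.
From mathcomp Require Import all_classical all_reals all_analysis.
From mathcomp Require Import ring.

(** Write [eta] for dX3 and [xi] for the third coordinate field, so that [g(xi, u) = eps eta(u)].
    A Levi-Civita connection of a nondegenerate metric is unique ([levi_civita_unique]), so the
    given one has the explicit Christoffel symbols of [christoffel eps], and a computation of
    components gives

      Ric = 2 eta (x) eta,   R = g /\ Ric - (eps/2) g /\ g,   kappa = 2 eps

    ([ricE], [riem_roter], [kappaE]). From there on no coordinates are needed for the first
    group of identities. Put G = g /\ g. The formula for R gives (lemmas [conformalE],
    [conharmonicE], [concircularE])

      C = 0,   K = - (eps/2) G,   W = R - (eps/6) G.

    If two tensors E, E' satisfy E(u, v, y, w) = E'(u, v, y, w) + c (Z(v, y) g(u, w) - Z(u, y) g(v, w)),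
    then E.F = E'.F + c Q(Z, F) for every multilinear F ([act_shift]). Hence

      K.F = - eps Q(g, F),   W.F = R.F - (eps/3) Q(g, F),   P.F = R.F - (1/2) Q(Ric, F),

    and all the identities reduce to six: R.R = eps Q(g, R), R.G = 0, R.P = eps Q(g, P),
    Q(g, G) = 0, Q(Ric, G) = - 2 Q(g, R) and Q(Ric, R) = eps Q(g, R). Each of these tensors is a
    polynomial in the values of g and eta on its arguments, and the curvature endomorphism
    takes values whose pairing with g and eta is again such a polynomial ([metric_endo_riem],
    [eta_endo_riem]); so the six are polynomial identities with eps^2 = 1, true in any
    dimension for a unit covector eta.

    The ranks are read on diagonal Gram matrices, Ric^2 = 2 eps Ric because the Ricci operator
    is [2 eps eta(u) xi], and the covariant derivative of Ric has the nonzero component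
    (1; 1, 3) but vanishing component (3; 1, 1), which excludes both the Codazzi and the cyclic
    parallel property. *)

Set Implicit Arguments.
Unset Strict Implicit.
Unset Printing Implicit Defensive.

Import Order.TTheory GRing.Theory Num.Theory.
Local Open Scope ring_scope.

(** * Multilinear forms on R^3 *)

Section Multilinear.
Variable R : realType.
Implicit Types (F : quad R) (A : bil R) (u v w : vec R) (a : R).

Definition bilinear2 A :=
  (forall a u v w, A (a *: u + v) w = a * A u w + A v w) /\
  (forall a u v w, A w (a *: u + v) = a * A w u + A w v).

Definition multilinear4 F :=
  [/\ forall a u v x y z, F (a *: u + v) x y z = a * F u x y z + F v x y z,
      forall a u v x y z, F x (a *: u + v) y z = a * F x u y z + F x v y z,
      forall a u v x y z, F x y (a *: u + v) z = a * F x y u z + F x y v z &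
      forall a u v x y z, F x y z (a *: u + v) = a * F x y z u + F x y z v].

Lemma linear_expand (f : vec R -> R) :
  (forall a u v, f (a *: u + v) = a * f u + f v) ->
  forall u, f u = \sum_i u 0 i * f (e i).
Proof.
move=> fP u.
pose fL := GRing.isLinear.Build R (vec R) R *%R f fP.
pose g : {linear vec R -> R | *%R} := HB.pack f fL.
rewrite -[f]/(g : vec R -> R) {1}[u]row_sum_delta linear_sum.
by apply: eq_bigr => i _; rewrite linearZ.
Qed.

Lemma multilinear4_expand F : multilinear4 F -> forall x y z w,
  F x y z w = \sum_h \sum_k \sum_i \sum_j
    x 0 h * y 0 k * z 0 i * w 0 j * F (e h) (e k) (e i) (e j).
Proof.
move=> [F1 F2 F3 F4] x y z w.
rewrite (linear_expand (f := (fun u => F u y z w))) //; apply: eq_bigr => h _.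
rewrite (linear_expand (f := (fun u => F (e h) u z w))) // mulr_sumr; apply: eq_bigr => k _.
rewrite (linear_expand (f := (fun u => F (e h) (e k) u w))) // !mulr_sumr; apply: eq_bigr => i _.
rewrite (linear_expand (f := (fun u => F (e h) (e k) (e i) u))) // !mulr_sumr.
by apply: eq_bigr => j _; rewrite !mulrA.
Qed.

Lemma multilinear4_KN A A' : bilinear2 A -> bilinear2 A' -> multilinear4 (KN A A').
Proof.
move=> [Al Ar] [Al' Ar']; split=> a u v x y z;
by rewrite /KN ?Al ?Ar ?Al' ?Ar'; ring.
Qed.

(** For [A0], [A1], [A2] the metric and the first two powers of the Ricci tensor, this presents the
    formula for the curvature as one of generalized Roter type. *)
Lemma KN_generalized_roter (A2 A1 A0 : bil R) c :
  KN A0 A1 + c *: KN A0 A0 =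
  KN (0 *: A2 + 0 *: A1 + 0 *: A0) A2 + KN (0 *: A1 + 1 *: A0) A1 + c *: KN A0 A0.
Proof.
by do 4 apply/funext => ?; rewrite /KN !fctE /GRing.scale /=; ring.
Qed.

Lemma multilinear4_lin F F' a :
  multilinear4 F -> multilinear4 F' -> multilinear4 (F + a *: F').
Proof.
move=> [F1 F2 F3 F4] [H1 H2 H3 H4].
by split=> b u v x y z; rewrite !fctE /GRing.scale /= ?F1 ?F2 ?F3 ?F4 ?H1 ?H2 ?H3 ?H4; ring.
Qed.

End Multilinear.

(** * Musical isomorphisms and uniqueness of the Levi-Civita connection *)

Section Nondegenerate.
Variables (R : realType) (g : tensor2 R) (p : vec R).
Hypothesis gP : bilinear2 (g p).
Hypothesis gU : gram (g p) \in unitmx.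

(** [sharp] is defined by inverting the Gram matrix on the right of a row, so the row form
    of lowering an index is what its characterisations cancel against. *)
Lemma row_gram (v : vec R) : v *m gram (g p) = \row_m g p v (e m).
Proof.
apply/rowP => m; rewrite !mxE (linear_expand (f := (fun v => g p v (e m)))) ?gP.1 //; last by case: gP.
by apply: eq_bigr => i _; rewrite !mxE.
Qed.

Lemma sharp_unique (w : vec R -> R) (v : vec R) :
  (forall u, w u = g p v u) -> sharp g p w = v.
Proof.
move=> wv; rewrite /sharp /ginv.
have -> : \row_m w (e m) = v *m gram (g p).
  by rewrite row_gram; apply/rowP => m; rewrite !mxE.
by rewrite mulmxK.
Qed.

Lemma sharp_dual (w : vec R -> R) :
  (forall a u v, w (a *: u + v) = a * w u + w v) ->
  forall u, g p (sharp g p w) u = w u.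
Proof.
move=> wP u; rewrite (linear_expand (f := (g p (sharp g p w)))); last by case: gP.
rewrite [RHS]linear_expand //; apply: eq_bigr => i _; congr (_ * _).
have /rowP/(_ i) := row_gram (sharp g p w).
by rewrite /sharp /ginv mulmxKV // !mxE => ->.
Qed.

Lemma nondegenerate_eq0 (v : vec R) : (forall u, g p v u = 0) -> v = 0.
Proof.
move=> v0; rewrite -[v](mulmxK gU) row_gram.
by rewrite (_ : \row_m _ = 0) ?mul0mx //; apply/rowP => m; rewrite !mxE.
Qed.

End Nondegenerate.

Lemma nabla_basis (R : realType) (Gam : connection R) (Z : tensor2 R) p i j k :
  nabla Gam Z p (e i) (e j) (e k) =
    partial i (fun q => Z q (e j) (e k)) p
     - \sum_a Gam p a i j * Z p (e a) (e k) - \sum_a Gam p a i k * Z p (e j) (e a).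
Proof.
rewrite /nabla (bigD1 i) //= [X in _ + X]big1 ?addr0; last first.
  by move=> m /negPf nm; apply: big1 => n _; apply: big1 => o _; rewrite !mxE nm !mul0r.
rewrite (bigD1 j) //= [X in _ + X]big1 ?addr0; last first.
  by move=> m /negPf nm; apply: big1 => n _; rewrite !mxE nm mulr0 !mul0r.
rewrite (bigD1 k) //= [X in _ + X]big1 ?addr0; last first.
  by move=> m /negPf nm; rewrite !mxE nm mulr0 !mul0r.
by rewrite !mxE !eqxx !mul1r.
Qed.

(** The difference [D] of the two connections, lowered by [g], is symmetric in its first
    two slots (no torsion) and skew in its last two (both are metric); three
    transpositions of each kind compose to the identity, so it equals its opposite. *)
Lemma levi_civita_unique (R : realType) (g : tensor2 R) (Gam Gam' : connection R) :
  (forall p, bilinear2 (g p)) -> sym2 g -> (forall p, gram (g p) \in unitmx) ->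
  levi_civita g Gam -> levi_civita g Gam' -> Gam = Gam'.
Proof.
move=> gP gS gU [tf mc] [tf' mc'].
pose D p i j : vec R := \row_a (Gam p a i j - Gam' p a i j).
have DE p i j k : g p (D p i j) (e k) =
   \sum_a Gam p a i j * g p (e a) (e k) - \sum_a Gam' p a i j * g p (e a) (e k).
  rewrite (linear_expand (f := (fun v => g p v (e k)))); last by case: (gP p).
  by rewrite -sumrB; apply: eq_bigr => a _; rewrite mxE mulrBl.
have Dsym p i j k : g p (D p i j) (e k) = g p (D p j i) (e k).
  by congr (g p _ _); apply/rowP => a; rewrite !mxE tf tf'.
have Dskew p i j k : g p (D p i j) (e k) = - g p (D p i k) (e j).
  have := nabla_basis Gam g p i j k; rewrite mc.
  have := nabla_basis Gam' g p i j k; rewrite mc' /= => -> /eqP.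
  have S (G : connection R) : \sum_a G p a i k * g p (e j) (e a) = \sum_a G p a i k * g p (e a) (e j).
    by apply: eq_bigr => a _; rewrite gS.
  rewrite !S !DE -subr_eq0 => /eqP h; apply/eqP; rewrite -subr_eq0; apply/eqP.
  by rewrite -[RHS]h; ring.
have D0 p i j k : g p (D p i j) (e k) = 0.
  have : g p (D p i j) (e k) = - g p (D p i j) (e k).
    by rewrite {1}Dskew Dsym Dskew opprK Dsym Dskew Dsym.
  by move=> /eqP; rewrite -addr_eq0 -mulr2n mulrn_eq0 /= => /eqP.
apply/funext => p; apply/funext => a; apply/funext => i; apply/funext => j.
have /rowP/(_ a) : D p i j = 0.
  apply: (nondegenerate_eq0 (gP p) (gU p)) => u.
  rewrite (linear_expand (f := (g p (D p i j)))); last by case: (gP p).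
  by apply: big1 => k _; rewrite D0 mulr0.
by rewrite !mxE => /eqP; rewrite subr_eq0 => /eqP.
Qed.

(** * The metric and its curvature *)

Section Metric.
Variables (R : realType) (eps : R).
Hypothesis eps2 : eps * eps = 1.
Implicit Types (p u v w : vec R).

Local Notation g := (metric eps).
Local Notation eta := (dX i3).
Local Notation xi := (e i3).

Lemma metricE p u v : g p u v =
  expR (2 * p 0 i3) * (u 0 i1 * v 0 i1) + expR (- 2 * p 0 i3) * (u 0 i2 * v 0 i2)
  + eps * (u 0 i3 * v 0 i3).
Proof. by []. Qed.

Lemma expR_coord p : expR (2 * p 0 i3) * expR (- 2 * p 0 i3) = 1 :> R.
Proof. by rewrite -expRD -mulrDl subrr mul0r expR0. Qed.

Lemma metric_bilinear p : bilinear2 (g p).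
Proof. by split=> a u v w; rewrite !metricE !mxE; ring. Qed.

Lemma metricDl p u v w : g p (u + v) w = g p u w + g p v w.
Proof. by rewrite !metricE !mxE; ring. Qed.

Lemma metricZl p a u w : g p (a *: u) w = a * g p u w.
Proof. by rewrite !metricE !mxE; ring. Qed.

Lemma metric_sym : sym2 g.
Proof. by move=> p u v; rewrite !metricE; ring. Qed.

Lemma metric_gram_unit p : gram (g p) \in unitmx.
Proof.
pose d : 'rV[R]_3 := \row_j [:: expR (2 * p 0 i3); expR (- 2 * p 0 i3); eps]`_j.
have -> : gram (g p) = diag_mx d.
  apply/matrixP => i j; rewrite !mxE metricE !mxE.
  by case: i => [[|[|[|?]]] ?] //; case: j => [[|[|[|?]]] ?] //;
    rewrite !eqE /= ?mulr0n ?mulr1n; ring.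
rewrite unitmxE det_diag !big_ord_recl big_ord0 !mxE /= mulr1 mulrA expR_coord mul1r.
by apply/unitrPr; exists eps.
Qed.

Lemma sharp_metric p (w : vec R -> R) v :
  (forall u, w u = g p v u) -> sharp g p w = v.
Proof. exact: (sharp_unique (metric_bilinear p) (metric_gram_unit p)). Qed.

Lemma dX_lin (i : 'I_3) a u v : dX i (a *: u + v) = a * dX i u + dX i v :> R.
Proof. by rewrite /dX !mxE. Qed.

Lemma metric_xi p u : g p xi u = eps * eta u.
Proof. by rewrite metricE !mxE /= /dX; ring. Qed.

Lemma partial_cst (i : 'I_3) (c : R) p : partial i (fun=> c) p = 0.
Proof. exact: derive_cst. Qed.

Lemma partial_exp (i : 'I_3) (b c : R) p :
  partial i (fun q => b * expR (c * q 0 i3)) p = (i == i3)%:R * (b * (c * expR (c * p 0 i3))).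
Proof.
have DF (x : R) : is_derive x (1:R) (fun y => b * expR (c * y)) (b * (c * expR (c * x))).
  have E : is_derive x (1:R) (fun y : R => expR (c * y)) (expR (c * x) * c).
    by apply: is_derive1_comp; apply: is_derive_eq; rewrite /GRing.scale /= mulr1.
  by apply: is_derive_eq; rewrite /GRing.scale /=; ring.
rewrite /partial (derive_coord (fun y => b * expR (c * y)) i3 (e i) p) mxE eqxx /= [i3 == _]eq_sym.
by case: (i == i3); [rewrite derive_val mul1r|rewrite derive0 mul0r].
Qed.

(** The only non-constant Christoffel symbols are the two with upper index 3 and equal
    lower indices, and they depend on the third coordinate alone. *)
Lemma partial_christoffel (i a k j : 'I_3) p :
  partial i (fun q => christoffel eps q a k j) p =
  (i == i3)%:R * match val a, val k, val j with
    | 2%N, 0%N, 0%N => - eps * (2 * expR (2 * p 0 i3))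
    | 2%N, 1%N, 1%N => eps * (- 2 * expR (- 2 * p 0 i3))
    | _, _, _ => 0
    end.
Proof.
move: a k j => [[|[|[|?]]] ?] [[|[|[|?]]] ?] [[|[|[|?]]] ?] //;
  rewrite /christoffel /= ?partial_cst ?mulr0 //.
- by rewrite partial_exp.
- by rewrite partial_exp.
Qed.

(** The value found for the Riemann tensor. It involves the point only through the metric,
    which is what makes every later identity algebraic in [g] and [eta]. *)
Definition roter_form p : quad R :=
  KN (g p) (2 *: otimes eta eta) - (eps / 2) *: KN (g p) (g p).

(** Since [KN (g p) (g p)] is twice an integral expression in the values of [g p], the factor 1/2
    disappears and the expanded form has integer coefficients. *)
Lemma roter_formE p u v w z : roter_form p u v w z =
  2 * (g p u z * (eta v * eta w) - g p u w * (eta v * eta z)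
       + g p v w * (eta u * eta z) - g p v z * (eta u * eta w))
  - eps * (g p u z * g p v w - g p u w * g p v z).
Proof.
rewrite /roter_form /KN /otimes !fctE /GRing.scale /=.
by field.
Qed.

Lemma roter_form_multilinear p : multilinear4 (roter_form p).
Proof.
have [gl gr] := metric_bilinear p.
by split=> a u v x y z; rewrite !roter_formE ?gl ?gr ?dX_lin; ring.
Qed.

Lemma metric_orthogonal p (h a : 'I_3) : a != h -> g p (e h) (e a) = 0.
Proof.
rewrite metricE !mxE.
by move: h a => [[|[|[|?]]] ?] [[|[|[|?]]] ?] //; rewrite !eqE /=; move=> _; ring.
Qed.

(** By orthogonality of the frame only the term [a = h] survives the lowering of the first
    index; what remains is a check in each of the 81 components, using [eps ^+ 2 = 1]
    and that the two exponentials are inverse to each other. *)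
Lemma riem_comp_christoffel p (h k i j : 'I_3) :
  riem_comp g (christoffel eps) p h k i j = roter_form p (e h) (e k) (e i) (e j).
Proof.
rewrite /riem_comp roter_formE (bigD1 h) // [X in _ + X = _]big1 ?addr0; last first.
  by move=> a ah; rewrite metric_orthogonal ?mul0r.
rewrite !big_ord_recl !big_ord0 !partial_christoffel.
have hh := expR_coord p.
rewrite !metricE /dX !mxE.
case: h => [[|[|[|?]]] ?] //; case: k => [[|[|[|?]]] ?] //;
case: i => [[|[|[|?]]] ?] //; case: j => [[|[|[|?]]] ?] //; rewrite !eqE /christoffel /=.
all: ring: eps2 hh.
Qed.

End Metric.

(** * The action of an endomorphism-valued tensor *)

Lemma sum3 (R : nmodType) (F : 'I_3 -> R) : \sum_i F i = F i1 + F i2 + F i3.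
Proof.
rewrite !big_ord_recl big_ord0 addr0 addrA.
by congr (F _ + F _ + F _); apply: val_inj.
Qed.

Section Action.
Variables (R : realType) (g : tensor2 R).
Implicit Types (E F : tensor4 R) (Z : tensor2 R) (c : R).

(** The difference [E - E'] has as endomorphism
    [y |-> c Z(v, y) u - c Z(u, y) v], and the derivation it induces on tensors is [c Q(Z, -)]
    by the very definition of [Q]. This is how the conharmonic, concircular and projective
    tensors are compared with [0] and with the Riemann tensor. *)
Lemma act_shift E E' Z F c :
  (forall p, bilinear2 (g p)) -> (forall p, gram (g p) \in unitmx) ->
  (forall p, multilinear4 (F p)) ->
  (forall p u v y w, E p u v y w =
     E' p u v y w + c * (Z p v y * g p u w - Z p u y * g p v w)) ->
  act g E F = act g E' F + c *: Q Z F.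
Proof.
move=> gP gU FP EE'.
have endoE p u v y :
  endo g E p u v y = (- (c * Z p u y)) *: v + ((c * Z p v y) *: u + endo g E' p u v y).
  rewrite /endo /sharp.
  have -> : \row_m E p u v y (e m) = \row_m E' p u v y (e m)
      + ((c * Z p v y) *: u - (c * Z p u y) *: v) *m gram (g p).
    rewrite mulmxBl -!scalemxAl !row_gram //.
    by apply/rowP => m; rewrite !mxE EE'; ring.
  by rewrite mulmxDl mulmxK // scaleNr addrC -addrA addrCA addrA addrC addrA.
apply/funext => p; do 6 apply/funext => ?.
have [F1 F2 F3 F4] := FP p.
rewrite /act /Q !fctE !endoE !(F1, F2, F3, F4) /GRing.scale /=.
ring.
Qed.

Lemma act0l F : (forall p, multilinear4 (F p)) -> act g 0 F = 0.
Proof.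
move=> FP; apply/funext => p; do 6 apply/funext => ?.
have endo0 u v y : endo g 0 p u v y = 0.
  rewrite /endo /sharp (_ : \row_m _ = 0) ?mul0mx //.
  by apply/rowP => m; rewrite !mxE.
have F0 (f : vec R -> R) : (forall a u v, f (a *: u + v) = a * f u + f v) -> f 0 = 0.
  by move=> fP; have := fP (-1) 0 0; rewrite scaler0 addr0 mulN1r addNr.
have [F1 F2 F3 F4] := FP p.
have Z1 x y z : F p 0 x y z = 0 by apply: (F0 (fun u => F p u x y z)).
have Z2 x y z : F p x 0 y z = 0 by apply: (F0 (fun u => F p x u y z)).
have Z3 x y z : F p x y 0 z = 0 by apply: (F0 (fun u => F p x y u z)).
have Z4 x y z : F p x y z 0 = 0 by apply: (F0 (F p x y z)).
by rewrite /act !endo0 Z1 Z2 Z3 Z4 !(oppr0, addr0).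
Qed.

Lemma act0r E : act g E 0 = 0.
Proof. by do 7 apply/funext => ?; rewrite /act !(oppr0, addr0). Qed.

Lemma act_lin E F F' c : act g E (F + c *: F') = act g E F + c *: act g E F'.
Proof. by do 7 apply/funext => ?; rewrite /act !fctE /GRing.scale /=; ring. Qed.

Lemma Q_lin Z F F' c : Q Z (F + c *: F') = Q Z F + c *: Q Z F'.
Proof. by do 7 apply/funext => ?; rewrite /Q !fctE /GRing.scale /=; ring. Qed.

End Action.

(** * Ricci tensor, scalar curvature and derived tensors *)

(** Gives each unordered pair of arguments of the metric a single orientation, so that
    [ring] sees one atom for it. *)
Ltac symmetrize_metric :=
  repeat match goal with
  | |- context [metric ?eps ?p ?u ?v] =>
    match goal with
    | |- context [metric eps p v u] =>
      tryif constr_eq u v then fail else rewrite (metric_sym eps p v u)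
    end
  end.

Section Curvatures.
Variables (R : realType) (eps : R) (Gam : connection R).
Hypothesis eps2 : eps * eps = 1.
Hypothesis GamP : levi_civita (metric eps) Gam.
Implicit Types (p u v y w x z s : vec R).

Local Notation g := (metric eps).
Local Notation eta := (dX i3).
Local Notation xi := (e i3).
Local Notation Rm := (riem g Gam).
Local Notation Ric := (ric g Gam).

Lemma levi_civita_metric : Gam = christoffel eps.
Proof.
apply: levi_civita_unique GamP (levi_civita_christoffel _).
- exact: metric_bilinear.
- exact: metric_sym.
- exact: metric_gram_unit.
- by rewrite expr2.
Qed.

Lemma riemE p : Rm p = roter_form eps p.
Proof.
rewrite levi_civita_metric; do 4 apply/funext => ?.
rewrite /riem (multilinear4_expand (roter_form_multilinear eps p)).
do 4 (apply: eq_bigr => ? _).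
by rewrite riem_comp_christoffel.
Qed.

(** Its trace in [u] gives the Ricci tensor. Beyond that only its pairings with [g] and [eta]
    matter, because the tensors on which the curvature acts are built from [g] and [eta]. *)
Lemma endo_riem p u v y : endo g Rm p u v y =
  (2 * eta v * eta y - eps * g p v y) *: u
  + (eps * g p u y - 2 * eta u * eta y) *: v
  + (2 * eps * (g p v y * eta u - g p u y * eta v)) *: xi.
Proof.
apply: sharp_metric => // w.
rewrite !metricDl !metricZl metric_xi riemE roter_formE.
by ring: eps2.
Qed.

Lemma metric_endo_riem p u v y w : g p (endo g Rm p u v y) w = roter_form eps p u v y w.
Proof.
rewrite /endo riemE; apply: sharp_dual.
- exact: metric_bilinear.
- exact: metric_gram_unit.
- by have [_ _ _] := roter_form_multilinear eps p; move=> F4 *; apply: F4.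
Qed.

Lemma metric_endo_riemr p u v y w : g p w (endo g Rm p u v y) = roter_form eps p u v y w.
Proof. by rewrite metric_sym metric_endo_riem. Qed.

Lemma eta_endo_riem p u v y :
  eta (endo g Rm p u v y) = eps * (g p v y * eta u - g p u y * eta v).
Proof. by rewrite endo_riem /dX !mxE /=; ring. Qed.

Lemma ricE p : Ric p = 2 *: otimes eta eta.
Proof.
apply/funext => v; apply/funext => y.
rewrite /ric /mxtrace; under eq_bigr => i _ do rewrite mxE endo_riem.
rewrite sum3 /otimes !fctE !metricE /dX !mxE.
have ab := expR_coord p.
rewrite /GRing.scale /=.
ring: eps2 ab.
Qed.

Lemma ric_coord p u v : Ric p u v = 2 * (eta u * eta v).
Proof. by rewrite ricE. Qed.

(** The Ricci operator has rank one, with image spanned by the unit vector [xi] dual to [eta]. *)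
Lemma sharp_ric p v : sharp g p (Ric p v) = (2 * eps * eta v) *: xi.
Proof.
apply: sharp_metric => // u.
by rewrite ric_coord metricE !mxE /= /dX; ring: eps2.
Qed.

Lemma ricci_opE p v : ricci_op g Gam p v = (2 * eps * eta v) *: xi.
Proof.
rewrite -(sharp_ric p) /ricci_op; congr sharp; apply/funext => u.
by rewrite !ric_coord; ring.
Qed.

Lemma ric_pow2E p : ric_pow g Gam 2 p = (2 * eps) *: Ric p.
Proof.
apply/funext => u; apply/funext => v.
rewrite /ric_pow /= !ricci_opE !fctE ric_coord metricE !mxE /= /dX !mxE /GRing.scale /=.
ring: eps2.
Qed.

Lemma kappaE p : kappa g Gam p = 2 * eps.
Proof.
(* [Ric] has the single component 2 in place (3, 3), so that [kappa] is twice the (3, 3) entry of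
   the inverse metric, which is the third coordinate of the vector dual to [eta]. *)
have -> : kappa g Gam p = 2 * ginv g p i3 i3.
  by rewrite /kappa sum3 !sum3 !ric_coord /dX !mxE /=; ring.
have -> : ginv g p i3 i3 = sharp g p eta 0 i3.
  by rewrite /sharp mxE sum3 /dX !mxE /=; ring.
rewrite (_ : sharp g p eta = eps *: xi); first by rewrite !mxE mulr1.
by apply: sharp_metric => // u; rewrite metricE !mxE /= /dX; ring: eps2.
Qed.

Local Notation G := (fun p => KN (g p) (g p)).
Local Notation C := (conformal g Gam).
Local Notation K := (conharmonic g Gam).
Local Notation W := (concircular g Gam).
Local Notation P := (projective g Gam).

Lemma riem_roter p : Rm p = KN (g p) (Ric p) - (eps / 2) *: KN (g p) (g p).
Proof. by rewrite riemE ricE. Qed.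

Lemma KN_metricE p u v w z : KN (g p) (g p) u v w z = 2 * (g p u z * g p v w - g p u w * g p v z).
Proof. rewrite /KN; ring. Qed.

Lemma conharmonicE : K = (- (eps / 2)) *: (G : tensor4 R).
Proof.
apply/funext => p; rewrite /conharmonic riem_roter.
by do 4 apply/funext => ?; rewrite !fctE /GRing.scale /=; field.
Qed.

(** The Weyl tensor vanishes, as it must in dimension three. *)
Lemma conformalE : C = 0.
Proof.
apply/funext => p; rewrite /conformal riem_roter kappaE.
by do 4 apply/funext => ?; rewrite !fctE /GRing.scale /= -[RHS]/(0 : R); by field.
Qed.

Lemma concircularE : W = (Rm : tensor4 R) + (- (eps / 6)) *: (G : tensor4 R).
Proof.
apply/funext => p; rewrite /concircular kappaE.
by do 4 apply/funext => ?; rewrite !fctE /GRing.scale /=; field.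
Qed.

Lemma projectiveE p u v w z : P p u v w z =
  roter_form eps p u v w z - (g p u z * (eta v * eta w) - g p v z * (eta u * eta w)).
Proof. by rewrite /projective riemE !ric_coord; field. Qed.

Lemma KN_metric_multilinear p : multilinear4 (KN (g p) (g p)).
Proof. by apply: multilinear4_KN; apply: metric_bilinear. Qed.

Lemma riem_multilinear p : multilinear4 (Rm p).
Proof. by rewrite riemE; apply: roter_form_multilinear. Qed.

Lemma projective_multilinear p : multilinear4 (P p).
Proof.
have [F1 F2 F3 F4] := roter_form_multilinear eps p.
have [gl gr] := metric_bilinear eps p.
by split=> a u v x y z; rewrite !projectiveE ?F1 ?F2 ?F3 ?F4 ?gl ?gr ?dX_lin; ring.
Qed.

Lemma act_riem F p a b c d u v :
  act g Rm F p a b c d u v =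
  - F p (endo g Rm p u v a) b c d - F p a (endo g Rm p u v b) c d
  - F p a b (endo g Rm p u v c) d - F p a b c (endo g Rm p u v d).
Proof. by []. Qed.

Lemma act_riem_riem : act g Rm Rm = eps *: Q g Rm.
Proof.
do 7 apply/funext => ?.
rewrite act_riem /Q !fctE !riemE !roter_formE
  !(metric_endo_riem, metric_endo_riemr, eta_endo_riem) !roter_formE /GRing.scale /=.
by symmetrize_metric; ring: eps2.
Qed.

(** The curvature endomorphisms are skew for [g], so as derivations they kill [g], hence [KN g g]. *)
Lemma act_riem_G : act g Rm G = 0.
Proof.
do 7 apply/funext => ?.
rewrite -[RHS]/(0 : R) act_riem !KN_metricE !(metric_endo_riem, metric_endo_riemr) !roter_formE.
by symmetrize_metric; ring: eps2.
Qed.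

Lemma act_riem_projective : act g Rm P = eps *: Q g P.
Proof.
do 7 apply/funext => ?.
rewrite act_riem /Q !fctE !projectiveE !roter_formE
  !(metric_endo_riem, metric_endo_riemr, eta_endo_riem) !roter_formE /GRing.scale /=.
by symmetrize_metric; ring: eps2.
Qed.

(** The endomorphisms that define [Q g] are skew for [g] as well. *)
Lemma Q_metric_G : Q g G = 0.
Proof.
do 7 apply/funext => ?.
rewrite -[RHS]/(0 : R) /Q !KN_metricE.
by symmetrize_metric; ring.
Qed.

(** An instance of the polarised identity relating [Q A (KN g g)] to [Q g (KN g A)];
    [Q g (KN g Ric)] is [Q g Rm] because [Q g] kills [KN g g]. *)
Lemma Q_ric_G : Q Ric G = - 2 *: Q g Rm.
Proof.
do 7 apply/funext => ?.
rewrite /Q !fctE !KN_metricE !riemE !roter_formE !ric_coord /GRing.scale /=.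
by symmetrize_metric; ring: eps2.
Qed.

(** [Q Ric (KN g Ric)] is a multiple of [Q g (KN Ric Ric)], and [KN Ric Ric] vanishes because
    [Ric] has rank one; the [KN g g] part of the curvature contributes through [Q_ric_G]. *)
Lemma Q_ric_riem : Q Ric Rm = eps *: Q g Rm.
Proof.
do 7 apply/funext => ?.
rewrite /Q !fctE !riemE !roter_formE !ric_coord /GRing.scale /=.
by symmetrize_metric; ring: eps2.
Qed.

End Curvatures.

(** * Curvature identities, ranks, compatibility *)

Section Identities.
Variables (R : realType) (eps : R) (Gam : connection R).
Hypothesis eps2 : eps * eps = 1.
Hypothesis GamP : levi_civita (metric eps) Gam.

Local Notation g := (metric eps).
Local Notation eta := (dX i3).
Local Notation xi := (e i3).
Local Notation Rm := (riem g Gam).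
Local Notation Ric := (ric g Gam).
Local Notation G := ((fun p => KN (g p) (g p)) : tensor4 R).
Local Notation C := (conformal g Gam).
Local Notation K := (conharmonic g Gam).
Local Notation W := (concircular g Gam).
Local Notation P := (projective g Gam).

Lemma act_conharmonic F : (forall p, multilinear4 (F p)) -> act g K F = - eps *: Q g F.
Proof.
move=> FP; rewrite -[RHS]add0r -(act0l g FP).
apply: act_shift => //; [exact: metric_bilinear|exact: metric_gram_unit|].
move=> p u v y w; rewrite conharmonicE // !fctE KN_metricE /GRing.scale /= -[(0 : tensor4 R) p u v y w]/(0 : R).
by field.
Qed.

Lemma act_concircular F : (forall p, multilinear4 (F p)) ->
  act g W F = act g Rm F - (eps / 3) *: Q g F.
Proof.
move=> FP; rewrite -scaleNr.
apply: act_shift => //; [exact: metric_bilinear|exact: metric_gram_unit|].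
move=> p u v y w; rewrite concircularE // !fctE KN_metricE /GRing.scale /=.
by field.
Qed.

Lemma act_projective F : (forall p, multilinear4 (F p)) ->
  act g P F = act g Rm F - (1 / 2) *: Q Ric F.
Proof.
move=> FP; rewrite -scaleNr.
apply: act_shift => //; [exact: metric_bilinear|exact: metric_gram_unit|].
move=> p u v y w; rewrite projectiveE // riemE // !ric_coord //.
by field.
Qed.

(** All the scalar functions that occur below are constant. *)
Lemma smooth_cst (c : R) : smooth (fun=> c).
Proof.
move=> s.
suff [d ->] : exists d, foldr (@partial R) (fun=> c) s = fun=> d by [].
elim: s => [|i s [d IH]]; first by exists c.
by exists 0; rewrite /= IH; apply/funext => p; rewrite partial_cst.
Qed.

Lemma ricci_gen_pseudosymmetric_cst E F c :
  act g E F = c *: Q Ric F -> ricci_gen_pseudosymmetric_type g Gam E F.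
Proof. by move=> EF; exists (fun=> c) => [|p]; [exact: smooth_cst|rewrite EF]. Qed.

Lemma pseudosymmetric_cst (Z : tensor2 R) E F c :
  act g E F = c *: Q Z F -> pseudosymmetric_type g Z E F.
Proof.
move=> EF p; exists 1, (- c); rewrite oner_eq0; split=> //.
by rewrite EF scale1r scaleNr -[(c *: Q Z F) p]/(c *: Q Z F p) subrr.
Qed.

(** In the coordinate frame [g] and [Ric] are simultaneously diagonal, so ranks are read off. *)
Lemma gram_ric_shift p c : gram (Ric p - c *: g p) =
  diag_mx (\row_j [:: - c * expR (2 * p 0 i3); - c * expR (- 2 * p 0 i3); 2 - c * eps]`_j).
Proof.
apply/matrixP => i j; rewrite !mxE.
rewrite -[(Ric p - c *: g p) _ _]/(Ric p (e i) (e j) - c * g p (e i) (e j)).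
rewrite ric_coord // metricE /dX !mxE.
by case: i => [[|[|[|?]]] ?] //; case: j => [[|[|[|?]]] ?] //;
  rewrite !eqE /= ?mulr0n ?mulr1n; ring.
Qed.

Lemma diag_unitmx (d : 'rV[R]_3) : (forall i, d 0 i != 0) -> diag_mx d \in unitmx.
Proof.
move=> d0; rewrite unitmxE det_diag unitfE.
by apply/prodf_neq0 => i _.
Qed.

Lemma rank_ric p : \rank (gram (Ric p - 0 *: g p)) = 1.
Proof.
rewrite gram_ric_shift (_ : diag_mx _ = 2 *: delta_mx i3 i3); last first.
  apply/matrixP => i j; rewrite !mxE.
  by case: i => [[|[|[|?]]] ?] //; case: j => [[|[|[|?]]] ?] //;
    rewrite !eqE /= ?mulr0n ?mulr1n; ring.
by rewrite mxrank_scale_nz ?mxrank_delta // pnatr_eq0.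
Qed.

Lemma rank_ric_shift2 p : eps = 1 -> \rank (gram (Ric p - 2 *: g p)) = 2.
Proof.
move=> eps1; rewrite gram_ric_shift.
(* The third diagonal entry 2 - 2 eps vanishes; any nonzero entry may stand for it in the unit factor. *)
pose d : 'rV[R]_3 := \row_j [:: - 2 * expR (2 * p 0 i3); - 2 * expR (- 2 * p 0 i3); 1]`_j.
have dU : diag_mx d \in unitmx.
  apply: diag_unitmx => i; rewrite mxE.
  by case: i => [[|[|[|?]]] ?] //=; rewrite ?oner_eq0 // mulf_neq0 ?oppr_eq0 ?pnatr_eq0 // gt_eqF // expR_gt0.
rewrite (_ : diag_mx _ = diag_mx d *m pid_mx 2); last first.
  apply/matrixP => i j; rewrite mul_diag_mx !mxE eps1.
  by case: i => [[|[|[|?]]] ?] //; case: j => [[|[|[|?]]] ?] //;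
    rewrite !eqE /= ?mulr0n ?mulr1n; ring.
by rewrite eqmxMfull ?row_full_unit // rank_pid_mx.
Qed.

Lemma rank_ric_shift3 p : eps = -1 -> \rank (gram (Ric p - 2 *: g p)) = 3.
Proof.
move=> epsN1; rewrite gram_ric_shift mxrank_unit //.
apply: diag_unitmx => i; rewrite mxE.
case: i => [[|[|[|?]]] ?] //=.
1,2: by rewrite mulf_neq0 ?oppr_eq0 ?pnatr_eq0 // gt_eqF // expR_gt0.
by rewrite epsN1 mulrN1 opprK -natrD pnatr_eq0.
Qed.

Lemma nabla_ric p i j k : nabla Gam Ric p (e i) (e j) (e k) =
  - 2 * (christoffel eps p i3 i j * eta (e k) + christoffel eps p i3 i k * eta (e j)).
Proof.
rewrite nabla_basis !sum3.
rewrite (_ : (fun q => _) = fun=> 2 * (eta (e j) * eta (e k))); last first.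
  by apply/funext => q; rewrite ric_coord.
rewrite partial_cst !ric_coord // (levi_civita_metric eps2 GamP) /dX !mxE /=; ring.
Qed.

Lemma eps_neq0 : eps != 0.
Proof. by apply/eqP => eps0; have /eqP := eps2; rewrite eps0 mul0r eq_sym oner_eq0. Qed.

(** At any point, the derivative of [Ric] along [e i1] on [(e i3, e i1)] is a nonzero multiple
    of the third Christoffel symbol of [(e i1, e i1)], while its derivative along [e i3] on [(e i1, e i1)] vanishes. *)
Lemma ric_not_codazzi : ~ codazzi Gam Ric.
Proof.
move=> /(_ 0 (e i1) (e i3) (e i1)); rewrite !nabla_ric /christoffel /dX !mxE /= [2 * 0]mulr0 expR0 => h.
have /eqP : 2 * eps = 0 by move/eqP: h; rewrite -subr_eq0 => /eqP h; rewrite -[RHS]h; ring.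
by rewrite mulf_eq0 pnatr_eq0 (negPf eps_neq0).
Qed.

Lemma ric_not_cyclic_parallel : ~ cyclic_parallel Gam Ric.
Proof.
move=> /(_ 0 (e i1) (e i1) (e i3)); rewrite !nabla_ric /christoffel /dX !mxE /= [2 * 0]mulr0 expR0 => h.
have /eqP : 4 * eps = 0 by rewrite -[RHS]h; ring.
by rewrite mulf_eq0 pnatr_eq0 (negPf eps_neq0).
Qed.

Lemma compatible_lin (T T' : tensor4 R) Z c :
  compatible g T Z -> compatible g T' Z -> compatible g (T + c *: T') Z.
Proof.
move=> [ZS TZ] [_ TZ']; split=> // p U Y1 Y2 Y3 z.
rewrite !fctE; have := TZ p U Y1 Y2 Y3; have := TZ' p U Y1 Y2 Y3; rewrite -/z => h' h.
transitivity ((T p (z Y1) U Y2 Y3 + T p (z Y2) U Y3 Y1 + T p (z Y3) U Y1 Y2)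
 + c * (T' p (z Y1) U Y2 Y3 + T' p (z Y2) U Y3 Y1 + T' p (z Y3) U Y1 Y2)).
  by rewrite /GRing.scale /=; ring.
by rewrite h h' mulr0 addr0.
Qed.

Lemma ric_sym : sym2 Ric.
Proof. by move=> p u v; rewrite !ric_coord //; ring. Qed.

Lemma compatible0 : compatible g 0 Ric.
Proof. by split=> [|p U Y1 Y2 Y3]; [exact: ric_sym|rewrite /= !addr0]. Qed.

Lemma compatible_G : compatible g G Ric.
Proof.
split=> [|p U Y1 Y2 Y3 z]; first exact: ric_sym.
rewrite /z !sharp_ric // !KN_metricE.
rewrite !metricZl !metric_xi.
by symmetrize_metric; ring.
Qed.

(** The Ricci operator takes values in the line of [xi], and the curvature with [xi] in its
    first slot is built from [g] and [eta] only; the cyclic sum then cancels in pairs. *)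
Lemma compatible_riem : compatible g Rm Ric.
Proof.
split=> [|p U Y1 Y2 Y3 z]; first exact: ric_sym.
rewrite /z !sharp_ric // riemE // !roter_formE.
have etaZ a : eta (a *: xi) = a :> R by rewrite /dX !mxE /= mulr1.
rewrite !metricZl !metric_xi !etaZ.
by symmetrize_metric; ring.
Qed.

Lemma act_lin0 E F F' c : act g E F' = 0 -> act g E (F + c *: F') = act g E F.
Proof.
move=> EF'; rewrite act_lin EF'; do 7 apply/funext => ?.
by rewrite !fctE /GRing.scale /= mulr0 addr0.
Qed.

Lemma Q_lin0 (Z : tensor2 R) F F' c : Q Z F' = 0 -> Q Z (F + c *: F') = Q Z F.
Proof.
move=> ZF'; rewrite Q_lin ZF'; do 7 apply/funext => ?.
by rewrite !fctE /GRing.scale /= mulr0 addr0.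
Qed.

Lemma Q_metric_concircular : Q g W = Q g Rm.
Proof.
rewrite (concircularE eps2 GamP) Q_lin Q_metric_G; do 7 apply/funext => ?.
by rewrite !fctE /GRing.scale /= mulr0 addr0.
Qed.

Lemma act_riem_concircular : act g Rm W = eps *: Q g W.
Proof.
rewrite Q_metric_concircular (concircularE eps2 GamP).
rewrite act_lin (act_riem_G eps2 GamP) (act_riem_riem eps2 GamP); do 7 apply/funext => ?.
by rewrite !fctE /GRing.scale /= mulr0 addr0.
Qed.

Lemma Q_ric_concircular : Q Ric W = (4 / 3 * eps) *: Q g W.
Proof.
rewrite Q_metric_concircular (concircularE eps2 GamP) Q_lin.
rewrite (Q_ric_riem eps2 GamP) (Q_ric_G eps2 GamP); do 7 apply/funext => ?.
by rewrite !fctE /GRing.scale /=; field.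
Qed.

Lemma act_riem_conharmonic : act g Rm K = 0.
Proof.
rewrite (conharmonicE eps2 GamP) -[_ *: _]add0r.
by rewrite (act_lin0 _ _ (act_riem_G eps2 GamP)) act0r.
Qed.

Lemma Q_metric_conharmonic : Q g K = 0.
Proof.
rewrite (conharmonicE eps2 GamP) -[_ *: _]add0r (Q_lin0 _ _ (Q_metric_G _)).
by do 7 apply/funext => ?; rewrite /Q !mulr0 !(addr0, subr0).
Qed.

Lemma concircular_multilinear p : multilinear4 (W p).
Proof.
rewrite concircularE //.
exact: (multilinear4_lin _ (riem_multilinear eps2 GamP p) (KN_metric_multilinear eps p)).
Qed.

Lemma conharmonic_multilinear p : multilinear4 (K p).
Proof.
rewrite conharmonicE // -[_ *: _]add0r.
apply: (multilinear4_lin _ _ (KN_metric_multilinear eps p)).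
by split=> *; rewrite mulr0 addr0.
Qed.

End Identities.

(** * Assembling the identities *)

Lemma tensor6_0 (R : realType) p (a b c d u v : vec R) : (0 : tensor6 R) p a b c d u v = 0.
Proof. by []. Qed.

Ltac pointwise :=
  do 7 apply/funext => ?; rewrite !fctE /GRing.scale /= ?tensor6_0; by field.

Theorem theorem4p1 (R : realType) (eps : R) (heps : eps = 1 \/ eps = -1)
    (Gam : connection R) (hGam : levi_civita (metric eps) Gam) :
  let g := metric eps in
  let Ric := ric g Gam in
  let Rm := riem g Gam in
  let C := conformal g Gam in
  let K := conharmonic g Gam in
  let W := concircular g Gam in
  let P := projective g Gam in
  let semisym := semisymmetric_type g in
  let pseudosym := pseudosymmetric_type g g in
  let ricci_gen_pseudosym := ricci_gen_pseudosymmetric_type g Gam in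
  (* (I) *)
  ((act g C Rm = 0 /\
    act g K Rm = - Q Ric Rm /\
    act g W Rm = (2 / 3) *: Q Ric Rm /\
    act g P Rm = (1 / 2) *: Q Ric Rm /\
    act g K Rm = - (eps *: Q g Rm) /\
    act g W Rm = (2 / 3 * eps) *: Q g Rm /\
    act g P Rm = (1 / 2 * eps) *: Q g Rm /\
    act g Rm C = 0 /\
    act g C C = 0 /\
    act g K C = 0 /\
    act g W C = 0 /\
    act g P C = 0 /\
    act g Rm K = 0 /\
    act g C K = 0 /\
    act g K K = 0 /\
    act g W K = 0 /\
    act g P K = - ((1 / 2) *: Q Ric K) /\
    act g Rm W = (3 / 4) *: Q Ric W /\
    act g K W = - ((3 / 4) *: Q Ric W) /\
    act g W W = (1 / 2) *: Q Ric W /\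
    act g P W = (1 / 4) *: Q Ric W /\
    act g Rm W = eps *: Q g W /\
    act g K W = - (eps *: Q g W) /\
    act g W W = (2 / 3 * eps) *: Q g W /\
    act g P W = (1 / 3 * eps) *: Q g W /\
    act g Rm P = eps *: Q g P /\
    act g K P = - (eps *: Q g P) /\
    act g W P = (2 / 3 * eps) *: Q g P) /\
   ([/\ semisym C Rm, semisym Rm C, semisym C C, semisym K C & semisym W C] /\
    [/\ semisym P C, semisym Rm K, semisym C K, semisym K K & semisym W K] /\
    [/\ ricci_gen_pseudosym K Rm, ricci_gen_pseudosym W Rm,
        ricci_gen_pseudosym P Rm & ricci_gen_pseudosym P K] /\
    [/\ ricci_gen_pseudosym Rm W, ricci_gen_pseudosym K W,
        ricci_gen_pseudosym W W & ricci_gen_pseudosym P W] /\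
    [/\ pseudosym K Rm, pseudosym W Rm & pseudosym P Rm] /\
    [/\ pseudosym Rm W, pseudosym K W, pseudosym W W & pseudosym P W] /\
    [/\ pseudosym Rm P, pseudosym K P & pseudosym W P])) /\
  (* (II) *)
  ((forall p, Ric p = 2 *: otimes (dX i3) (dX i3)) /\
   ricci_simple g Gam /\
   (eps = 1 -> rank_ric_shift g Gam (fun=> 2) 2 /\ quasi_einstein g Gam 2) /\
   (eps = -1 -> rank_ric_shift g Gam (fun=> 2) 3 /\ quasi_einstein g Gam 3)) /\
  (* (III) *)
  ((forall p, Rm p = KN (g p) (Ric p) - (eps / 2) *: KN (g p) (g p)) /\
   generalized_roter g Gam) /\
  (* (IV) *)
  ((forall p, ric_pow g Gam 2 p - (2 * eps) *: Ric p = 0) /\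
   einstein_level2 g Gam) /\
  (* (V) *)
  (~ codazzi Gam Ric /\ ~ cyclic_parallel Gam Ric) /\
  (* (VI) *)
  (compatible g Rm Ric /\ compatible g C Ric /\
   compatible g K Ric /\ compatible g W Ric).
Proof.
have eps2 : eps * eps = 1 by case: heps => ->; rewrite ?mulrNN mulr1.
move=> g Ric Rm C K W P semisym pseudosym ricci_gen_pseudosym.
have C0 : C = 0 := conformalE eps2 hGam.
have RmM : forall p, multilinear4 (Rm p) := riem_multilinear eps2 hGam.
have KM : forall p, multilinear4 (K p) := conharmonic_multilinear eps2 hGam.
have WM : forall p, multilinear4 (W p) := concircular_multilinear eps2 hGam.
have PM : forall p, multilinear4 (P p) := projective_multilinear eps2 hGam.
have actK := act_conharmonic eps2 hGam.
have actW := act_concircular eps2 hGam.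
have actP := act_projective eps2 hGam.
have RR : act g Rm Rm = eps *: Q g Rm := act_riem_riem eps2 hGam.
have RK : act g Rm K = 0 := act_riem_conharmonic eps2 hGam.
have RW : act g Rm W = eps *: Q g W := act_riem_concircular eps2 hGam.
have RP : act g Rm P = eps *: Q g P := act_riem_projective eps2 hGam.
have QRm : Q Ric Rm = eps *: Q g Rm := Q_ric_riem eps2 hGam.
have QgK : Q g K = 0 := Q_metric_conharmonic eps2 hGam.
have QW : Q Ric W = (4 / 3 * eps) *: Q g W := Q_ric_concircular eps2 hGam.
have CR : act g C Rm = 0 by rewrite C0 act0l.
have KR_ric : act g K Rm = - Q Ric Rm by rewrite QRm (actK _ RmM); pointwise.
have WR_ric : act g W Rm = (2 / 3) *: Q Ric Rm by rewrite (actW _ RmM) RR QRm; pointwise.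
have PR_ric : act g P Rm = (1 / 2) *: Q Ric Rm by rewrite (actP _ RmM) RR QRm; pointwise.
have KR_g : act g K Rm = - (eps *: Q g Rm) by rewrite (actK _ RmM); pointwise.
have WR_g : act g W Rm = (2 / 3 * eps) *: Q g Rm by rewrite (actW _ RmM) RR; pointwise.
have PR_g : act g P Rm = (1 / 2 * eps) *: Q g Rm by rewrite (actP _ RmM) RR QRm; pointwise.
have CK : act g C K = 0 by rewrite C0 act0l.
have KK : act g K K = 0 by rewrite (actK _ KM) QgK; pointwise.
have WK : act g W K = 0 by rewrite (actW _ KM) RK QgK; pointwise.
have PK : act g P K = - ((1 / 2) *: Q Ric K) by rewrite (actP _ KM) RK; pointwise.
have RW_ric : act g Rm W = (3 / 4) *: Q Ric W by rewrite RW QW; pointwise.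
have KW_ric : act g K W = - ((3 / 4) *: Q Ric W) by rewrite (actK _ WM) QW; pointwise.
have WW_ric : act g W W = (1 / 2) *: Q Ric W by rewrite (actW _ WM) RW QW; pointwise.
have PW_ric : act g P W = (1 / 4) *: Q Ric W by rewrite (actP _ WM) RW QW; pointwise.
have KW_g : act g K W = - (eps *: Q g W) by rewrite (actK _ WM); pointwise.
have WW_g : act g W W = (2 / 3 * eps) *: Q g W by rewrite (actW _ WM) RW; pointwise.
have PW_g : act g P W = (1 / 3 * eps) *: Q g W by rewrite (actP _ WM) RW QW; pointwise.
have KP : act g K P = - (eps *: Q g P) by rewrite (actK _ PM); pointwise.
have WP : act g W P = (2 / 3 * eps) *: Q g P by rewrite (actW _ PM) RP; pointwise.
have to0 E : act g E C = 0 by rewrite C0 act0r.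
have rgp c E F : act g E F = c *: Q Ric F -> ricci_gen_pseudosym E F.
  exact: ricci_gen_pseudosymmetric_cst.
have ps c E F : act g E F = c *: Q g F -> pseudosym E F.
  exact: pseudosymmetric_cst.
split; first split; first by do !split.
  split; first by do !split.
  split; first by do !split.
  split.
    split; [apply: (rgp (-1))|apply: rgp WR_ric|apply: rgp PR_ric|apply: (rgp (- (1 / 2)))].
    - by rewrite KR_ric; pointwise.
    - by rewrite PK; pointwise.
  split.
    split; [apply: rgp RW_ric|apply: (rgp (- (3 / 4)))|apply: rgp WW_ric|apply: rgp PW_ric].
    by rewrite KW_ric; pointwise.
  split; first by split; [apply: ps (actK _ RmM)|apply: ps WR_g|apply: ps PR_g].
  split; first by split; [apply: ps RW|apply: ps (actK _ WM)|apply: ps WW_g|apply: ps PW_g].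
  by split; [apply: ps RP|apply: ps (actK _ PM)|apply: ps WP].
split.
  split; first by move=> p; apply: ricE.
  split; first by move=> p; apply: rank_ric.
  have qe k : rank_ric_shift g Gam (fun=> 2) k -> quasi_einstein g Gam k.
    by exists (fun=> 2); first exact: smooth_cst.
  split=> h.
    have rk : rank_ric_shift g Gam (fun=> 2) 2 by move=> p; apply: rank_ric_shift2.
    by split=> //; apply: qe.
  have rk : rank_ric_shift g Gam (fun=> 2) 3 by move=> p; apply: rank_ric_shift3.
  by split=> //; apply: qe.
split.
  have roter p : Rm p = KN (g p) (Ric p) - (eps / 2) *: KN (g p) (g p).
    exact: riem_roter.
  split=> //.
  exists (fun=> 0), (fun=> 0), (fun=> 0), (fun=> 0), (fun=> 1), (fun=> - (eps / 2)).
  do 2 (split; first by split; apply: smooth_cst).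
  by move=> p; rewrite -/(Rm p) roter -scaleNr; apply: KN_generalized_roter.
split.
  have ric2 p : ric_pow g Gam 2 p = (2 * eps) *: Ric p by apply: ric_pow2E.
  split=> [p|]; first by rewrite ric2 subrr.
  exists (fun=> - (2 * eps)), (fun=> 0); split; [exact: smooth_cst..|] => p.
  rewrite ric2 -/(Ric p); do 2 apply/funext => ?.
  by rewrite !fctE /GRing.scale /= -[RHS]/(0 : R); ring.
split; first by split; [apply: ric_not_codazzi|apply: ric_not_cyclic_parallel].
have cR : compatible g Rm Ric by apply: compatible_riem.
have c0 : compatible g 0 Ric by apply: compatible0.
have cG := compatible_G eps2 hGam.
split=> //; split; first by rewrite C0.
split.
  by rewrite /K conharmonicE // -[_ *: _]add0r; apply: compatible_lin.
by rewrite /W concircularE //; apply: compatible_lin.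
Qed.
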